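(* Let $d$ and $N$ be positive integers, let $0<\gamma_1<\gamma<\gamma_2<\gamma_3$, and let $x,y\in\mathbb{C}$ satisfy $|x|<\gamma_1$, $\gamma_2<|y|<\gamma_3$ and $x\neq 0$. Let $\kappa(x,y)=1/(x-y)^d$ and let $\tilde\kappa(x,y)$ be its $N$-point proxy approximation with proxy surface the circle of radius $\gamma$ centered at $0$ (composite trapezoidal rule, as defined in the context). Then $$\tilde{\kappa}(x,y)=\kappa(x,y)\,\bigl(1+\varepsilon(x,y)\bigr),$$ where the relative approximation error $\varepsilon(x,y):=\dfrac{\tilde{\kappa}(x,y)-\kappa(x,y)}{\kappa(x,y)}$ is given by $$\varepsilon(x,y)=g\!\left(\Big(\frac{y}{\gamma}\Big)^N\right)+\sum_{j=0}^{d-1}\frac{(y-x)^j}{j!}\,\frac{\mathrm{d}^j}{\mathrm{d}x^j}\,g\!\left(\Big(\frac{\gamma}{x}\Big)^N\right).$$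
   Context: $g(z)=\frac{1}{z-1}$ for $z\neq 1$. The kernel is $\kappa(x,y)=\frac{1}{(x-y)^d}$ for $x,y\in\mathbb{C}$, $x\neq y$. For a radius $\gamma>0$, the proxy points are $z_j=\gamma\exp\!\left(\frac{2j\pi\mathbf{i}}{N}\right)$, $j=1,\dots,N$ (with $\mathbf{i}=\sqrt{-1}$), and the proxy approximation of the kernel is $$\tilde\kappa(x,y)=\sum_{j=1}^{N}\kappa(x,z_j)\,\phi(z_j,y),\qquad \phi(z,y)=\frac{1}{N}\,\frac{z}{y-z}\quad(y\neq z).$$ (This is the composite trapezoidal rule with weights $\omega_j=\frac{2\pi\mathbf{i}}{N}z_j$ applied to $\frac{1}{2\pi\mathbf{i}}\int_{|z|=\gamma}\frac{\kappa(x,z)}{y-z}\,\mathrm{d}z$.) The symbol $\frac{\mathrm{d}^j}{\mathrm{d}x^j}g((\gamma/x)^N)$ denotes the $j$-th complex derivative, with respect to $x$, of the function $x\mapsto g((\gamma/x)^N)$. *)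

(* Defs.v *)
From HB Require Import structures.
From mathcomp Require Import all_boot all_order all_algebra.
From mathcomp Require Import all_classical all_reals all_analysis.
From mathcomp Require Import complex.

Set Implicit Arguments.
Unset Strict Implicit.
Unset Printing Implicit Defensive.

Import Order.TTheory GRing.Theory Num.Theory.
Import numFieldNormedType.Exports.
Local Open Scope ring_scope.
Local Open Scope complex_scope.

Definition cexp (R : realType) (z : R[i]) : R[i] :=
  (expR (complex.Re z))%:C * (cos (complex.Im z) +i* sin (complex.Im z)).

Definition g (R : realType) (z : R[i]) : R[i] := 1 / (z - 1).

Definition kappa (R : realType) (d : nat) (x y : R[i]) : R[i] :=
  1 / (x - y) ^+ d.

Definition proxy_point (R : realType) (N : nat) (gamma : R) (j : nat) : R[i] :=
  gamma%:C * cexp (2 * j%:R * pi%:C * 'i / N%:R).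

Definition phi (R : realType) (N : nat) (z y : R[i]) : R[i] :=
  1 / N%:R * (z / (y - z)).

Definition kappa_tilde (R : realType) (d N : nat) (gamma : R) (x y : R[i]) :
    R[i] :=
  \sum_(1 <= j < N.+1) kappa d x (proxy_point N gamma j)
                       * phi N (proxy_point N gamma j) y.

Definition rel_error (R : realType) (d N : nat) (gamma : R) (x y : R[i]) :
    R[i] :=
  (kappa_tilde d N gamma x y - kappa d x y) / kappa d x y.

(* [derive1n] takes limits of difference quotients over the base field, here
   the numFieldType R[i], so this is the n-th complex derivative; the explicit
   base field is needed for the normed module structure of R[i] to be found. *)
Definition cderiv (R : realType) (n : nat) (f : R[i] -> R[i]) (x : R[i]) :
    R[i] :=
  @derive1n (R[i] : numFieldType) (R[i] : numFieldType) n f x.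

(* Main.v *)
Require Import Defs.
From HB Require Import structures.
From mathcomp Require Import all_boot all_order all_algebra.
From mathcomp Require Import all_classical all_reals all_analysis.
From mathcomp Require Import complex.
From mathcomp Require Import ring lra.

(* With w := y - x, the partial fraction expansion
   (x - y)^d / ((x - z)^d (y - z))
     = 1 / (y - z) + \sum_(j < d) (-1)^(j+1) w^j / (x - z)^(j+1)
   turns kappa_tilde / kappa into averages over the proxy points z of
   z / (y - z) and of z / (x - z)^(j+1).  As the proxy points are the roots of
   z^N = gamma^N, the average of z / (t - z) is g((t / gamma)^N); and since
   g(1/u) = - 1 - g(u), differentiating it j times at x gives the averages of
   z / (x - z)^(j+1) in terms of the derivatives of g((gamma / x)^N).  The
   constant - 1 survives only in the term j = 0, where it produces the leading 1
   of 1 + rel_error. *)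

Set Implicit Arguments.
Unset Strict Implicit.
Unset Printing Implicit Defensive.

Import Order.TTheory GRing.Theory Num.Theory.
Local Open Scope ring_scope.
Local Open Scope complex_scope.


Import numFieldNormedType.Exports.

(** * Sums over roots of unity *)

Lemma prim_root_power_sum (F : fieldType) (N m : nat) (w : F) :
  N.-primitive_root w -> ~~ (N %| m)%N ->
  \sum_(1 <= j < N.+1) (w ^+ j) ^+ m = 0.
Proof.
move=> wN mN.
have wm1 : w ^+ m - 1 != 0 by rewrite subr_eq0 -(prim_order_dvd wN).
apply: (mulfI wm1); rewrite mulr0 big_add1 /=.
under eq_bigr do rewrite exprAC exprS.
(* The factor [w ^+ m - 1] turns the geometric sum into [(w ^+ m) ^+ N - 1], which is 0. *)
rewrite -mulr_sumr mulrCA big_mkord -subrX1.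
by rewrite exprAC (prim_expr_order wN) expr1n subrr mulr0.
Qed.

(** Each node [z = c * w ^+ j] satisfies [z ^+ N = c ^+ N], so [t - z] divides [t ^+ N - c ^+ N] and
    the quotient times [z] is a polynomial in [z] with exponents 1 to [N]. Summing over the nodes
    kills every exponent but [N]. *)
Lemma prim_root_cauchy_sum (F : fieldType) (N : nat) (w c t : F) :
  N.-primitive_root w -> t ^+ N != c ^+ N ->
  \sum_(1 <= j < N.+1) c * w ^+ j / (t - c * w ^+ j)
    = N%:R * c ^+ N / (t ^+ N - c ^+ N).
Proof.
move=> wN tc.
have tcN : t ^+ N - c ^+ N != 0 by rewrite subr_eq0.
have zN j : (c * w ^+ j) ^+ N = c ^+ N.
  by rewrite exprMn exprAC (prim_expr_order wN) expr1n mulr1.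
have N0 := prim_order_gt0 wN.
apply: (mulIf tcN); rewrite mulfVK// mulr_suml.
transitivity (\sum_(1 <= j < N.+1) \sum_(k < N)
    t ^+ (N.-1 - k) * c ^+ k.+1 * (w ^+ j) ^+ k.+1).
  apply: eq_bigr => j _; rewrite -[in LHS](zN j) subrXX.
  have tz : t - c * w ^+ j != 0.
    by apply: contra tc; rewrite subr_eq0 => /eqP ->; rewrite zN.
  rewrite mulrA mulfVK// mulr_sumr; apply: eq_bigr => k _.
  rewrite mulrCA -exprS exprMn mulrA.
  by [].
rewrite exchange_big /=.
under eq_bigr do rewrite -mulr_sumr.
case: N N0 wN {zN tc tcN} => // n _ wN.
rewrite big_ord_recr /= big1 ?add0r => [|k _]; last first.
  by rewrite (prim_root_power_sum wN) ?mulr0// gtnNdvd// ltnS.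
rewrite subnn mul1r mulrC; congr (_ * _).
under eq_bigr do rewrite exprAC (prim_expr_order wN) expr1n.
by rewrite sumr_const_nat subSS subn0.
Qed.

(** * Iterated derivatives of sums of simple poles *)

Lemma is_derive_inv_shift_exp (K : numFieldType) (z x : K) (n : nat) :
  x != z ->
  is_derive x (1 : K) (fun t : K => ((t - z) ^+ n)^-1 : K)
    (- n%:R / (x - z) ^+ n.+1).
Proof.
move=> xz; have xz0 : x - z != 0 by rewrite subr_eq0.
have df : is_derive x (1 : K) ((fun t : K => t - z) ^+ n)
    ((n%:R * (x - z) ^+ n.-1) *: (1 : K)).
  by apply: is_deriveX; exact: is_derive_shift.
have fx : ((fun t : K => t - z) ^+ n) x = (x - z) ^+ n.
  by rewrite exprfctE.
have -> : (fun t : K => ((t - z) ^+ n)^-1)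
    = (fun t => (((fun t : K => t - z) ^+ n) t)^-1).
  by apply/funext => t; rewrite exprfctE.
apply: DeriveDef.
  by apply: derivableV; rewrite ?fx ?expf_neq0.
rewrite deriveV ?fx ?expf_neq0// derive_val.
(* The truncated exponent [n.-1] forces the case [n = 0] apart; both sides are then 0. *)
case: n {df fx} => [|n]; first by rewrite !mul0r scale0r scaler0 oppr0 mul0r.
rewrite /= [_ *: 1]mulr1 /GRing.scale /=.
by rewrite !exprS; field; rewrite xz0 expf_neq0.
Qed.

(** Functions equal near [x] are also equal near each point close to [x], so the induction
    hypothesis applies on a whole neighbourhood. *)
Lemma near_eq_derive1n (K : numFieldType) (V : normedModType K) (n : nat)
    (f h : K -> V) (x : K) :
  (\near x, f x = h x) -> derive1n n f x = derive1n n h x.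
Proof.
elim: n x => [|n IH] x fh; first exact: nbhs_singleton fh.
rewrite !derive1nS !derive1E; apply: near_eq_derive.
by move: fh => /nbhs_interior; apply: filterS => t /IH.
Qed.

Lemma near_neq (K : numFieldType) (x z : K) :
  x != z -> \forall t \near (x : K), t != z.
Proof.
move=> xz; apply/nbhs_ballP; exists `|x - z|.
  by rewrite /= normr_gt0 subr_eq0.
by move=> t; rewrite -ball_normE /=; case: eqVneq => // ->; rewrite ltxx.
Qed.

(** The closed form holds at every point off the poles, hence near [x], and can be differentiated
    once more. *)
Lemma derive1n_sum_poles (K : numFieldType) (m n : nat) (c : K)
    (a z : 'I_m -> K) (x : K) :
  (forall i, x != z i) ->
  derive1n n (fun t : K => c + \sum_(i < m) a i / (t - z i) : K) x
    = (n == 0%N)%:R * c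
      + (-1) ^+ n * n`!%:R * \sum_(i < m) a i / (x - z i) ^+ n.+1.
Proof.
elim: n x => [|n IH] x xz; first by rewrite !mul1r.
rewrite derive1nS derive1E mul0r add0r.
pose F t : K := (n == 0%N)%:R * c
  + \sum_(i < m) ((-1) ^+ n * n`!%:R * a i) *: ((t - z i) ^+ n.+1)^-1.
rewrite (@near_eq_derive _ _ _ _ F); last first.
  (* With finitely many poles, a single neighbourhood of [x] avoids them all. *)
  have : \forall t \near x, forall i, t != z i.
    exact: (@filter_forall _ _ (fun i t => t != z i) _
      (nbhs_filter (x : K)) (fun i => near_neq (xz i))).
  apply: filterS => t tz; rewrite IH// /F mulr_sumr; congr (_ + _).
  by apply: eq_bigr => i _; rewrite /GRing.scale /= mulrA.
have FE : F = cst ((n == 0%N)%:R * c) + \sum_(i < m)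
    (((-1) ^+ n * n`!%:R * a i) \*: (fun t : K => ((t - z i) ^+ n.+1)^-1 : K)).
  by apply/funext => t; rewrite /F fctE/= fct_sumE.
have dF i := is_deriveZ ((-1) ^+ n * n`!%:R * a i)
  (is_derive_inv_shift_exp n.+1 (xz i)).
rewrite FE.
have dS := is_derive_sum dF.
rewrite (@derive_val _ _ _ _ _ _ _ (is_deriveD (is_derive_cst _ x 1) dS)) add0r.
rewrite mulr_sumr; apply: eq_bigr => i _.
by rewrite /GRing.scale /= factS natrM [(-1) ^+ n.+1]exprS; ring.
Qed.

(** * Partial fractions *)

Lemma partial_fraction (F : fieldType) (d : nat) (a w : F) :
  a != 0 -> a + w != 0 ->
  (- w) ^+ d / a ^+ d / (a + w)
    = (a + w)^-1 + \sum_(0 <= j < d) (-1) ^+ j.+1 * w ^+ j / a ^+ j.+1.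
Proof.
move=> a0 b0; elim: d => [|d IH].
  by rewrite big_nil addr0 !expr0 divr1 mul1r.
(* Since [- w / a / (a + w) = (a + w)^-1 - a^-1], multiplying by [- w / a] shifts the sum by one
   index and supplies its new term at index 0. *)
transitivity (- w / a * ((- w) ^+ d / a ^+ d / (a + w))).
  by rewrite !exprS; field; rewrite b0 a0 expf_neq0.
rewrite IH mulrDr mulr_sumr big_nat_recl//= expr1 expr0 mulr1 expr1 addrA.
congr (_ + _); first by field; rewrite b0 a0.
apply: eq_bigr => i _; rewrite !exprS; field.
by rewrite a0 expf_neq0.
Qed.

(** * Proxy points as scaled roots of unity *)

Definition cis (R : realType) (t : R) : R[i] := cos t +i* sin t.

Lemma cisX (R : realType) (t : R) (n : nat) : cis t ^+ n = cis (t *+ n).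
Proof.
elim: n => [|n IH]; first by rewrite /cis mulr0n cos0 sin0.
by rewrite exprS IH mulrS /cis cosD sinD; simpc; congr (_ +i* _); rewrite addrC.
Qed.

(** By the double angle formula [cos t = 1] forces [sin (t / 2) = 0], whereas [sin] is positive
    strictly between 0 and [pi]. *)
Lemma cis_eq1 (R : realType) (t : R) : 0 <= t < pi *+ 2 -> cis t = 1 -> t = 0.
Proof.
move=> /andP[t0 tpi] [ct _]; apply/eqP.
rewrite -[_ == _]negbK neq_lt ltNge t0 /=.
apply/negP => tgt0.
have : 0 < sin (t / 2).
  by apply: sin_gt0_pi; rewrite divr_gt0// ltr_pdivrMr// mulr_natr.
suff -> : sin (t / 2) = 0 by rewrite ltxx.
apply/eqP; rewrite -sqrf_eq0 sin2cos2.
move: ct; rewrite [in LHS](splitr t) -mulr2n cos_mulr2n => ct.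
by apply/eqP; move: ct; lra.
Qed.

(** If the order [m] were less than [N], the angle [2 pi m / N] would lie below [2 pi] and be 0 by
    [cis_eq1], against [0 < m]. *)
Lemma cis_primitive_root (R : realType) (N : nat) :
  (0 < N)%N -> N.-primitive_root (cis (pi *+ 2 / N%:R : R)).
Proof.
move=> N0; set w := cis _.
have NR : (0 : R) < N%:R by rewrite ltr0n.
have wN : w ^+ N = 1.
  by rewrite cisX -[_ *+ N]mulr_natr mulfVK ?gt_eqF// /cis cos2pi sin2pi.
have [m wm mN] := prim_order_exists N0 wN.
move: (dvdn_leq N0 mN); rewrite leq_eqVlt => /predU1P[<- //|mltN].
have m0 := prim_order_gt0 wm.
have pi0 : (0 : R) < pi *+ 2 by rewrite pmulrn_lgt0// pi_gt0.
have := prim_expr_order wm; rewrite cisX => /cis_eq1.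
rewrite -[_ *+ m]mulr_natr mulrAC ltr_pdivrMr// ltr_pM2l// ltr_nat mltN.
rewrite !(mulr_ge0, invr_ge0) ?ler0n ?ltW// => /(_ isT) /eqP.
by rewrite !mulf_eq0 invr_eq0 !gt_eqF ?ltr0n.
Qed.

Lemma proxy_pointE (R : realType) (N : nat) (gamma : R) (j : nat) :
  proxy_point N gamma j = gamma%:C * cis (pi *+ 2 / N%:R) ^+ j.
Proof.
rewrite /proxy_point cisX; congr (_ * _).
have -> : 2 * j%:R * pi%:C * 'i / N%:R
    = Complex 0 (pi *+ 2 / N%:R *+ j) :> R[i].
  transitivity ((pi *+ 2 / N%:R *+ j)%:C * (Complex 0 1) : R[i]); last by simpc.
  rewrite -(mulr_natr (_ / _)) -(mulr_natr pi) !rmorphM fmorphV !rmorph_nat.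
  transitivity (2 * j%:R * pi%:C * Complex 0 1 / N%:R : R[i]); first by [].
  by rewrite /=; ring.
by rewrite /cexp /= expR0 mul1r.
Qed.

Lemma exprn_neq_gamma (R : realType) (N : nat) (gamma : R) (t : R[i]) :
  (0 < N)%N -> 0 < gamma ->
  (`|t| < gamma%:C) || (gamma%:C < `|t|) -> t ^+ N != gamma%:C ^+ N.
Proof.
move=> N0 gamma0.
have g0 : (0 : R[i]) <= gamma%:C by rewrite ler0c ltW.
move=> tg; apply: contraTN tg => /eqP /(congr1 Num.norm).
rewrite !normrX (ger0_norm g0) => /eqP.
by rewrite eqrXn2// => /eqP ->; rewrite ltxx.
Qed.

(** Serves both at [t = y] and at all [t] near [x], where the identity is differentiated. *)
Lemma proxy_sum (R : realType) (N : nat) (gamma : R) (t : R[i]) :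
  (0 < N)%N -> 0 < gamma -> t ^+ N != gamma%:C ^+ N ->
  N%:R^-1 * \sum_(1 <= j < N.+1)
      proxy_point N gamma j / (t - proxy_point N gamma j)
    = g ((t / gamma%:C) ^+ N).
Proof.
move=> N0 gamma0 tg.
have C_N0 : N%:R != 0 :> R[i] by rewrite pnatr_eq0 -lt0n.
have C_gamma0 : gamma%:C != 0 :> R[i].
  by rewrite (inj_eq (@complexI R) gamma 0) gt_eqF.
under eq_bigr do rewrite proxy_pointE.
rewrite (prim_root_cauchy_sum (cis_primitive_root R N0) tg) /g expr_div_n.
have ? : gamma%:C ^+ N != 0 :> R[i] by rewrite expf_neq0.
have ? : t ^+ N - gamma%:C ^+ N != 0 by rewrite subr_eq0.
by field; apply/and3P; rewrite mulN1r.
Qed.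

Lemma neq_proxy_point (R : realType) (N : nat) (gamma : R) (t : R[i])
    (j : nat) :
  (0 < N)%N -> t ^+ N != gamma%:C ^+ N -> t != proxy_point N gamma j.
Proof.
move=> N0; apply: contra => /eqP ->; rewrite proxy_pointE exprMn exprAC.
by rewrite (prim_expr_order (cis_primitive_root R N0)) expr1n mulr1.
Qed.

(** * Derivatives of [g] along [gamma / x] and the error formula *)

Lemma cderiv_g_proxy (R : realType) (N : nat) (gamma : R) (x : R[i])
    (n : nat) :
  (0 < N)%N -> 0 < gamma -> x != 0 -> `|x| < gamma%:C ->
  cderiv n (fun t : R[i] => g ((gamma%:C / t) ^+ N)) x
    = - (n == 0%N)%:R + (-1) ^+ n.+1 * n`!%:R / N%:R *
      \sum_(1 <= j < N.+1)
        proxy_point N gamma j / (x - proxy_point N gamma j) ^+ n.+1.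
Proof.
move=> N0 gamma0 x0 xg.
have C_gamma0 : gamma%:C != 0 :> R[i].
  by rewrite (inj_eq (@complexI R) gamma 0) gt_eqF.
pose z (i : 'I_N) := proxy_point N gamma i.+1.
(* This is [- 1 - g ((t / gamma) ^+ N)] with [g] expanded by [proxy_sum] into simple poles. *)
pose h (t : R[i]) := - 1 + \sum_(i < N) (- N%:R^-1 * z i) / (t - z i) : R[i].
have near_h : \forall t \near (x : (R[i] : numFieldType)),
    g ((gamma%:C / t) ^+ N) = h t.
  have near_lt : \forall t \near (x : (R[i] : numFieldType)), `|t| < gamma%:C.
    apply/nbhs_ballP; exists (gamma%:C - `|x|); first by rewrite /= subr_gt0.
    move=> t; rewrite -ball_normE /= ltrBrDl => xt.
    apply: le_lt_trans xt.
    by rewrite -[X in `|X| <= _](subrK x) addrC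
      (le_trans (ler_normD _ _))// distrC.
  (* The point 0 must be avoided: there division by zero gives [g 0 = - 1] on the left, while
     [h 0 = 0]. *)
  apply: filterS2 near_lt (near_neq x0) => t tg t0.
  have tN : t ^+ N != gamma%:C ^+ N by rewrite exprn_neq_gamma ?tg.
  transitivity (- 1 - g ((t / gamma%:C) ^+ N)).
    rewrite /g !expr_div_n.
    have ? : gamma%:C ^+ N != 0 :> R[i] by rewrite expf_neq0.
    have ? : t ^+ N != 0 by rewrite expf_neq0.
    have ? : t ^+ N - gamma%:C ^+ N != 0 by rewrite subr_eq0.
    have ? : gamma%:C ^+ N - t ^+ N != 0 by rewrite subr_eq0 eq_sym.
    by field; apply/and4P; rewrite !mulN1r.
  rewrite -proxy_sum// /h big_add1 big_mkord -mulNr mulr_sumr; congr (_ + _).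
  by apply: eq_bigr => i _; rewrite mulrA.
pose C : numFieldType := R[i].
rewrite /cderiv (@near_eq_derive1n C C n _ _ _ near_h).
rewrite (@derive1n_sum_poles C) => [|i]; last first.
  by rewrite neq_proxy_point// exprn_neq_gamma ?xg.
rewrite big_add1 big_mkord mulrN1 !mulr_sumr; congr (_ + _).
by apply: eq_bigr => i _; rewrite [(-1) ^+ n.+1]exprS /z /=; ring.
Qed.

Lemma kappa_tilde_div_kappa (R : realType) (d N : nat) (gamma : R)
    (x y : R[i]) :
  (0 < d)%N -> (0 < N)%N -> 0 < gamma ->
  x != 0 -> `|x| < gamma%:C -> gamma%:C < `|y| ->
  kappa_tilde d N gamma x y / kappa d x y
    = 1 + g ((y / gamma%:C) ^+ N)
      + \sum_(0 <= j < d) (y - x) ^+ j / (j`!)%:R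
          * cderiv j (fun t : R[i] => g ((gamma%:C / t) ^+ N)) x.
Proof.
move=> d0 N0 gamma0 x0 xg yg.
have C_N0 : N%:R != 0 :> R[i] by rewrite pnatr_eq0 -lt0n.
have xN : x ^+ N != gamma%:C ^+ N by rewrite exprn_neq_gamma ?xg.
have yN : y ^+ N != gamma%:C ^+ N by rewrite exprn_neq_gamma ?yg ?orbT.
rewrite /kappa_tilde /kappa div1r invrK mulr_suml.
(* Dividing by [kappa] puts [(x - y) ^+ d] in each summand, which is then expanded by
   [partial_fraction] with [a = x - z] and [w = y - x]. *)
transitivity (\sum_(1 <= j < N.+1)
    (N%:R^-1 * (proxy_point N gamma j / (y - proxy_point N gamma j))
     + \sum_(0 <= i < d) N%:R^-1 * ((-1) ^+ i.+1 * (y - x) ^+ i *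
        (proxy_point N gamma j / (x - proxy_point N gamma j) ^+ i.+1)))).
  apply: eq_bigr => j _; rewrite /phi; move: (proxy_point N gamma j)
    (neq_proxy_point j N0 xN) (neq_proxy_point j N0 yN) => z.
  rewrite -subr_eq0 -(subr_eq0 y) => xz yz.
  have yzE : x - z + (y - x) = y - z by rewrite addrC addrA subrK.
  have := partial_fraction d xz; move=> /(_ (y - x)); rewrite yzE => /(_ yz).
  move=> /(congr1 (fun u => N%:R^-1 * z * u)).
  rewrite opprB mulrDr mulr_sumr => pf.
  transitivity (N%:R^-1 * z * ((x - y) ^+ d / (x - z) ^+ d / (y - z))).
    by field; apply/and3P; split; rewrite ?expf_neq0.
  by rewrite pf mulrA; congr (_ + _); apply: eq_bigr => i _; ring.
rewrite big_split /= -mulr_sumr proxy_sum// (addrC 1) -addrA; congr (_ + _).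
under [in RHS]eq_bigr do rewrite cderiv_g_proxy// mulrDr.
rewrite big_split /= addrA.
(* As [0 < d], the term [j = 0] is present; its [- 1] cancels the 1 on the right-hand side. *)
have -> : \sum_(0 <= j < d) (y - x) ^+ j / j`!%:R * - (j == 0%N)%:R = - 1.
  case: d d0 => // m _; rewrite big_nat_recl//= big1 => [|i _].
    by rewrite addr0 expr0 divr1 mul1r.
  by rewrite oppr0 mulr0.
rewrite subrr add0r exchange_big /=; apply: eq_bigr => i _.
rewrite !mulr_sumr; apply: eq_bigr => j _.
have fi : i`!%:R != 0 :> R[i] by rewrite pnatr_eq0 -lt0n fact_gt0.
set q := proxy_point N gamma j / _.
by field; apply/andP.
Qed.

Theorem theorem2p2 (R : realType) (d N : nat)
    (gamma1 gamma gamma2 gamma3 : R) (x y : R[i])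
    (hd : (0 < d)%N) (hN : (0 < N)%N)
    (hgamma1 : 0 < gamma1) (hgamma : gamma1 < gamma)
    (hgamma2 : gamma < gamma2) (hgamma3 : gamma2 < gamma3)
    (hx : `|x| < gamma1%:C) (hy2 : gamma2%:C < `|y|) (hy3 : `|y| < gamma3%:C)
    (hx0 : x != 0) :
  kappa_tilde d N gamma x y
    = kappa d x y * (1 + rel_error d N gamma x y)
  /\ rel_error d N gamma x y
    = g ((y / gamma%:C) ^+ N)
      + \sum_(0 <= j < d)
          (y - x) ^+ j / (j`!)%:R
          * cderiv j (fun t : R[i] => g ((gamma%:C / t) ^+ N)) x.
Proof.
have gamma0 : 0 < gamma by exact: lt_trans hgamma.
have xg : `|x| < gamma%:C by rewrite (lt_trans hx)// ltcR.
have yg : gamma%:C < `|y| by rewrite (lt_trans _ hy2)// ltcR.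
(* The circle of radius [gamma] separates [x] from [y], so [kappa] is a genuine nonzero quotient. *)
have xy : x - y != 0.
  by rewrite subr_eq0; apply: contraTneq (lt_trans xg yg) => ->; rewrite ltxx.
have k0 : kappa d x y != 0 by rewrite /kappa div1r invr_eq0 expf_neq0.
have rE : rel_error d N gamma x y = kappa_tilde d N gamma x y / kappa d x y - 1.
  by rewrite /rel_error mulrBl divff.
split; first by rewrite rE addrC subrK mulrC mulfVK.
by rewrite rE kappa_tilde_div_kappa// addrAC (addrC 1) addrK.
Qed.
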